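(* Let $p\ge 1$, $q\ge 0$ and $n\ge 1$ be integers. Then $$S_{p}^{(q)}(n)=\sum_{j=1}^{p}(-1)^{p+j}\genfrac{\{}{\}}{0pt}{}{p}{j}\binom{n+q+j}{q+j+1}\,j!.$$
   Context: The hyper-sums of powers of integers are defined by $S_p^{(0)}(n)=S_p(n)=1^p+2^p+\cdots+n^p$ and $S_{p}^{(q)}(n)=\sum_{k=1}^{n}S_{p}^{(q-1)}(k)$ for $q\ge 1$. $\genfrac{\{}{\}}{0pt}{}{p}{j}$ denotes the Stirling number of the second kind. *)

(* Defs.v *)
From mathcomp Require Import all_boot all_order all_algebra.

Set Implicit Arguments.
Unset Strict Implicit.
Unset Printing Implicit Defensive.

Fixpoint hyper_sum (p q n : nat) : nat :=
  match q with
  | 0 => \sum_(1 <= k < n.+1) k ^ p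
  | q'.+1 => \sum_(1 <= k < n.+1) hyper_sum p q' k
  end.

(* [partition] requires the blocks to be nonempty. *)
Definition stirling2 (p j : nat) : nat :=
  #|[set P : {set {set 'I_p}} | partition P [set: 'I_p] & #|P| == j]|.

(* Main.v *)
(** Grouping the [k ^ p] functions from ['I_p] to ['I_k] by the partition of
    ['I_p] into fibres gives [k ^ p = \sum_j S(p, j) k (k - 1) ... (k - j + 1)].
    This is a polynomial identity in [k], so [k] may be replaced by [- k], which
    turns falling factorials into the rising ones [j! C(k + j - 1, j)], up to
    sign.  The hockey-stick identity then performs the [q + 1] summations. *)

Require Import Defs.
From mathcomp Require Import all_boot all_order all_algebra.
From mathcomp Require Import ring.

Import GRing.Theory Num.Theory.

Local Open Scope ring_scope.

(** A partition is determined by its relation of lying in the same block, so equality of partitions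
    becomes equality of two relations. *)
Lemma eq_preim_partition (T rT : finType) (P : {set {set T}})
    (f : T -> rT) : partition P [set: T] ->
  (preim_partition f [set: T] == P) =
  [forall x, forall y, (y \in pblock P x) == (f x == f y)].
Proof.
move=> partP; apply/eqP/'forall_forallP => [<- x y|eqf].
  rewrite /preim_partition pblock_equivalence_partition ?inE //.
  by split=> // /eqP->.
rewrite -[RHS](equivalence_partition_pblock partP).
apply/setP=> B; apply/imsetP/imsetP=> -[x xT ->]; exists x => //;
  by apply/setP=> y; rewrite !inE (eqP (eqf x y)).
Qed.

(* A function with fibres [P] amounts to an injection from the blocks of [P]. *)
Lemma card_preim_partition (T rT : finType) (P : {set {set T}}) :
  partition P [set: T] ->
  #|[set f : {ffun T -> rT} | preim_partition f [set: T] == P]|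
  = (#|rT| ^_ #|P|)%N.
Proof.
move=> partP.
have [/eqP covP trivP P0] := and3P partP.
have inP x : pblock P x \in P by rewrite pblock_mem ?covP ?inE.
pose block x : {B | B \in P} := Sub (pblock P x) (inP x).
have block_surj (B : {B | B \in P}) : exists x, B == block x.
  have /set0Pn[x xB] : val B != set0 by apply: contraNneq P0 => <-; apply: valP.
  by exists x; rewrite -val_eqE /= (def_pblock trivP (valP B) xB).
have eq_block x y : (block x == block y) = (y \in pblock P x).
  by rewrite -val_eqE /= eq_pblock ?covP ?inE.
pose F (g : {ffun {B | B \in P} -> rT}) := [ffun x => g (block x)].
have F_inj : injective F.
  move=> g h /ffunP eqF; apply/ffunP=> B; have [x /eqP->] := block_surj B.
  by have := eqF x; rewrite !ffunE.
have cardP : #|{: {B | B \in P}}| = #|P| by rewrite card_sig; apply: eq_card.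
rewrite -cardP -card_inj_ffuns -(card_imset _ F_inj).
apply: eq_card => f; rewrite inE eq_preim_partition //.
apply/'forall_forallP/imsetP => [eqf|[g]].
  (* [f] is constant on each block, so its value at a chosen representative gives the injection. *)
  exists [ffun B => f (xchoose (block_surj B))].
    rewrite inE; apply/injectiveP => B C; rewrite !ffunE => /eqP.
    have /eqP eB := xchooseP (block_surj B).
    have /eqP eC := xchooseP (block_surj C).
    by rewrite -(eqP (eqf _ _)) -eq_block -eB -eC => /eqP.
  apply/ffunP=> x; rewrite !ffunE; apply/eqP.
  by rewrite -(eqP (eqf _ _)) -eq_block; apply: (xchooseP (block_surj _)).
rewrite inE => /injectiveP g_inj -> x y.
by rewrite !ffunE (inj_eq g_inj) eq_block.
Qed.

Lemma expn_stirling2_ffact (p k : nat) :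
  (k ^ p = \sum_(j < p.+1) stirling2 p j * k ^_ j)%N.
Proof.
have card_le (P : {set {set 'I_p}}) : partition P [set: 'I_p] -> (#|P| < p.+1)%N.
  move=> partP; rewrite ltnS -[leqRHS]card_ord -cardsT.
  have [_ trivP P0] := and3P partP.
  rewrite (card_partition partP) -sum1_card; apply: leq_sum => B BP.
  by rewrite card_gt0; apply: contraNneq P0 => <-.
rewrite -{1}[k]card_ord -{1}[p]card_ord -card_ffun -sum1_card.
rewrite (partition_big (fun f : {ffun 'I_p -> 'I_k} => preim_partition f setT)
  (fun P => partition P setT)) => [|f _]; last exact: preim_partitionP.
(* The partitions are now grouped by number of blocks; by [card_le], [inord] does not alter that
   number. *)
rewrite (partition_big
  (fun P : {set {set 'I_p}} => inord #|P| : 'I_p.+1) xpredT) //=.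
apply: eq_bigr => j _; rewrite /stirling2 -sum_nat_const.
apply: eq_big => [P|P /andP[partP /eqP <-]].
  rewrite inE; apply: andb_id2l => partP.
  by rewrite -val_eqE /= inordK // card_le.
rewrite inordK ?card_le // -[X in (X ^_ _)%N]card_ord -card_preim_partition //.
by rewrite -sum1_card; apply: eq_bigl => f; rewrite inE.
Qed.

(** At [k = 0] the power vanishes, hence so does the [j = 0] term. This lets the final sum start at
    [j = 1]. *)
Lemma stirling2_0r (p : nat) : (0 < p)%N -> stirling2 p 0 = 0%N.
Proof.
move=> p_gt0; have := expn_stirling2_ffact p 0.
by rewrite exp0n // big_ord_recl muln1; case: stirling2.
Qed.

(** Distinct naturals stay distinct in [R], so a nonzero [f - g] would have more roots than its
    degree. *)
Lemma eq_poly_nat (R : numDomainType) (f g : {poly R}) :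
  (forall k : nat, f.[k%:R] = g.[k%:R]) -> f = g.
Proof.
move=> eq_fg; apply/eqP; rewrite -subr_eq0; apply: contraT => nz.
have := @max_poly_roots _ _ [seq k%:R | k <- iota 0 (size (f - g))] nz.
rewrite size_map size_iota ltnn; apply.
  by apply/allP=> _ /mapP[k _ ->]; rewrite rootE !hornerE eq_fg subrr.
by rewrite map_inj_uniq ?iota_uniq // => a b /eqP; rewrite eqr_nat => /eqP.
Qed.

Lemma prodr_subn_ffact (R : pzRingType) (k j : nat) :
  \prod_(i < j) (k%:R - i%:R) = (k ^_ j)%:R :> R.
Proof.
elim: j => [|j IHj]; first by rewrite big_ord0.
rewrite big_ord_recr /= IHj ffactnSr natrM.
(* Where [k - j] truncates, the factor [k ^_ j] is already zero. *)
by have [/natrB->//|/ffact_small->] := leqP j k; rewrite !mul0r.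
Qed.

Lemma exprn_stirling2 (R : numDomainType) (p : nat) (x : R) :
  x ^+ p = \sum_(j < p.+1) (stirling2 p j)%:R * \prod_(i < j) (x - i%:R).
Proof.
pose g : {poly R} :=
  \sum_(j < p.+1) (stirling2 p j)%:R *: \prod_(i < j) ('X - i%:R%:P).
have gE y : g.[y] = \sum_(j < p.+1) (stirling2 p j)%:R * \prod_(i < j) (y - i%:R).
  rewrite horner_sum; apply: eq_bigr => j _; rewrite hornerZ horner_prod.
  by congr (_ * _); apply: eq_bigr => i _; rewrite !hornerE.
rewrite -gE -hornerXn; congr (_.[x]); apply: eq_poly_nat => k.
rewrite hornerXn gE -natrX expn_stirling2_ffact natr_sum.
by apply: eq_bigr => j _; rewrite natrM prodr_subn_ffact.
Qed.

Lemma prodr_oppn_bin (R : comPzRingType) (k j : nat) :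
  \prod_(i < j) (- k.+1%:R - i%:R) = (-1) ^+ j * ('C(k + j, j) * j`!)%:R :> R.
Proof.
rewrite bin_ffact; elim: j => [|j IHj]; first by rewrite big_ord0 mulr1.
rewrite big_ord_recr /= IHj addnS ffactSS -addSn natrM natrD exprS.
by ring.
Qed.

Lemma exprn_stirling2_bin (R : numDomainType) (p k : nat) :
  k.+1%:R ^+ p =
  \sum_(j < p.+1) (-1) ^+ (p + j) * (stirling2 p j)%:R * ('C(k + j, j) * j`!)%:R :> R.
Proof.
(* Expanding at the negative point [- k.+1] leaves the outer sign [(-1) ^+ p]. *)
rewrite -[k.+1%:R]opprK exprNn (exprn_stirling2 _ _ (- k.+1%:R)) mulr_sumr.
apply: eq_bigr => j _; rewrite prodr_oppn_bin exprD; ring.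
Qed.

Lemma sum_bin_hockey_stick (m n : nat) :
  (\sum_(0 <= k < n) 'C(k + m, m) = 'C(n + m, m.+1))%N.
Proof.
elim: n => [|n IHn]; first by rewrite big_nil bin_small.
by rewrite big_nat_recr //= IHn addSn binS.
Qed.

(** One summation raises [m] by one and leaves the coefficients [c] fixed. Evaluating [F] at [k.+1]
    shifts the range to start at 0, as the hockey-stick sum requires. *)
Lemma sum_bin_comb (c : nat -> int) (F : nat -> nat) (p m n : nat) :
  (forall k, (k.+1 <= n)%N ->
     (F k.+1)%:Z = \sum_(1 <= j < p.+1) c j * ('C(k + (m + j), m + j))%:Z) ->
  (\sum_(1 <= k < n.+1) F k)%N%:Z =
  \sum_(1 <= j < p.+1) c j * ('C(n + (m + j), (m + j).+1))%:Z.
Proof.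
move=> FE; rewrite (big_morph Posz PoszD erefl) big_add1 /=.
rewrite (eq_big_nat _ _ (F2 := fun k =>
  \sum_(1 <= j < p.+1) c j * ('C(k + (m + j), m + j))%:Z)) => [|k /andP[_ /FE]//].
rewrite exchange_big; apply: eq_bigr => j _ /=.
by rewrite -mulr_sumr -(big_morph Posz PoszD erefl) sum_bin_hockey_stick.
Qed.

Theorem theorem9 (p q n : nat) (hp : (1 <= p)%N) (hn : (1 <= n)%N) :
  (hyper_sum p q n)%:Z =
  \sum_(1 <= j < p.+1)
     (-1) ^+ (p + j) * (stirling2 p j)%:Z * ('C(n + q + j, q + j + 1))%:Z * (j`!)%:Z.
Proof.
(* The part of each term that depends on neither [n] nor [q]. *)
pose c j : int := (-1) ^+ (p + j) * (stirling2 p j)%:Z * (j`!)%:Z.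
have powE k : (k.+1 ^ p)%:Z = \sum_(1 <= j < p.+1) c j * ('C(k + j, j))%:Z.
  rewrite -natz natrX exprn_stirling2_bin big_ord_recl.
  rewrite stirling2_0r // mulr0 mul0r add0r.
  rewrite big_add1 big_mkord; apply: eq_bigr => j _.
  by rewrite !natz PoszM /c; ring.
under eq_bigr => j _ do rewrite mulrAC addn1 -addnA.
(* Here [m] is the number of summations already made: 0 for the powers, [q.+1] for
   [hyper_sum p q]. *)
elim: q n {hn} => [|q IHq] n /=; apply: sum_bin_comb => k _; first exact: powE.
by rewrite IHq; apply: eq_bigr => j _; rewrite addSnnS.
Qed.
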